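(* Let $n,m$ be positive integers, let $H\in\mathbb{R}^{n\times n}$ be symmetric positive semidefinite, let $f\in\mathbb{R}^n$, $A\in\mathbb{R}^{m\times n}$, $\underline{b},\overline{b}\in\mathbb{R}^m$, and let $\mathcal{B}\subseteq\{1,\dots,m\}$. Consider the mixed-integer quadratic program $$\underset{x\in\mathbb{R}^n}{\text{minimize}}\ \ \tfrac12 x^THx+f^Tx\quad\text{subject to}\quad \underline{b}\le Ax\le\overline{b},\qquad A_ix\in\{\underline{b}_i,\overline{b}_i\}\ \ \forall i\in\mathcal{B}.\qquad (P)$$ Adding to the objective function of $(P)$ regularizing terms of the form $\left\|A_ix-\frac{\underline{b}_i+\overline{b}_i}{2}\right\|_2^2$ with $i\in\mathcal{B}$ does not change the solution of $(P)$. That is, for every subset $\mathcal{I}\subseteq\mathcal{B}$, the set of (globally) optimal solutions of $$\underset{x\in\mathbb{R}^n}{\text{minimize}}\ \ \tfrac12 x^THx+f^Tx+\sum_{i\in\mathcal{I}}\left\|A_ix-\tfrac{\underline{b}_i+\overline{b}_i}{2}\right\|_2^2\quad\text{subject to}\quad \underline{b}\le Ax\le\overline{b},\qquad A_ix\in\{\underline{b}_i,\overline{b}_i\}\ \ \forall i\in\mathcal{B}$$ is equal to the set of (globally) optimal solutions of $(P)$.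
   Context: For a vector $v$, $v_i$ denotes its $i$-th element; for a matrix $M$, $M_i$ denotes its $i$-th row. Vector inequalities are understood elementwise. An optimal solution is a feasible point attaining the minimum of the objective over the feasible set. *)

(* Defs.v *)
From HB Require Import structures.
From mathcomp Require Import all_boot all_order all_algebra.
From mathcomp Require Import classical_sets reals.

Set Implicit Arguments.
Unset Strict Implicit.
Unset Printing Implicit Defensive.

Import Order.TTheory GRing.Theory Num.Theory.
Local Open Scope ring_scope.

Definition sym_psdmx (R : realType) (n : nat) (H : 'M[R]_n) : Prop :=
  H^T = H /\ forall x : 'cV[R]_n, 0 <= (x^T *m H *m x) 0 0.

Definition minimizers (R : realType) (T : Type) (F : T -> R) (S : set T) :
    set T :=
  [set x | S x /\ forall y, S y -> F x <= F y]%classic.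

(* The 1 x 1 products A_i x, x^T H x and f^T x are read as scalars through
   their only entry. *)
Definition rowval (R : realType) (m n : nat) (A : 'M[R]_(m, n)) (i : 'I_m)
    (x : 'cV[R]_n) : R :=
  (row i A *m x) 0 0.

Definition quad_obj (R : realType) (n : nat) (H : 'M[R]_n) (f : 'cV[R]_n)
    (x : 'cV[R]_n) : R :=
  2^-1 * (x^T *m H *m x) 0 0 + (f^T *m x) 0 0.

Definition miqp_feasible (R : realType) (m n : nat) (A : 'M[R]_(m, n))
    (bl bu : 'cV[R]_m) (B : {set 'I_m}) : set 'cV[R]_n :=
  [set x | (forall i : 'I_m, bl i 0 <= (A *m x) i 0 <= bu i 0) /\
           (forall i : 'I_m, i \in B ->
              rowval A i x = bl i 0 \/ rowval A i x = bu i 0)]%classic.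

(* The argument of each Euclidean norm is a scalar, hence the absolute value. *)
Definition reg_terms (R : realType) (m n : nat) (A : 'M[R]_(m, n))
    (bl bu : 'cV[R]_m) (I : {set 'I_m}) (x : 'cV[R]_n) : R :=
  \sum_(i in I) `|rowval A i x - (bl i 0 + bu i 0) / 2| ^+ 2.

(* Main.v *)
Require Import Defs.
From HB Require Import structures.
From mathcomp Require Import all_boot all_order all_algebra.
From mathcomp Require Import classical_sets reals.
From mathcomp Require Import ring.

(** On the feasible set, [A_i x] with [i] in [B] is one of the two endpoints
    [bl_i], [bu_i], and both endpoints lie at the same distance
    [|bu_i - bl_i| / 2] from their midpoint. Every regularizing term is thus
    constant on the feasible set ([reg_terms_feasible]), and shifting an
    objective by a constant preserves its minimizers ([minimizers_addr]). *)

Set Implicit Arguments.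
Unset Strict Implicit.
Unset Printing Implicit Defensive.

Import Order.TTheory GRing.Theory Num.Theory.
Local Open Scope ring_scope.

(** Minimality compares values at points of [S] alone, and there the shift
    cancels on both sides. *)
Lemma minimizers_addr (R : realType) (T : Type) (F G : T -> R) (S : set T)
    (c : R) (hG : forall x, S x -> G x = c) :
  minimizers (fun x => F x + G x) S = minimizers F S.
Proof.
apply/seteqP; split=> x [Sx min_x]; split=> // y Sy.
  by have := min_x y Sy; rewrite !hG // lerD2r.
by rewrite !hG // lerD2r min_x.
Qed.

Lemma sqr_dist_midpoint (R : realType) (a b x : R) :
  x = a \/ x = b -> `|x - (a + b) / 2| ^+ 2 = ((b - a) / 2) ^+ 2.
Proof. by rewrite real_normK ?num_real // => -[] ->; field. Qed.

Lemma reg_terms_feasible (R : realType) (n m : nat) (A : 'M[R]_(m, n))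
    (bl bu : 'cV[R]_m) (B I : {set 'I_m}) (x : 'cV[R]_n) :
  I \subset B -> miqp_feasible A bl bu B x ->
  reg_terms A bl bu I x = \sum_(i in I) ((bu i 0 - bl i 0) / 2) ^+ 2.
Proof.
move=> /fintype.subsetP sIB [_ endpt_x]; apply: eq_bigr => i Ii.
exact/sqr_dist_midpoint/endpt_x/sIB.
Qed.

Theorem proposition5 (R : realType) (n m : nat) (hn : (0 < n)%N) (hm : (0 < m)%N)
    (H : 'M[R]_n) (f : 'cV[R]_n) (A : 'M[R]_(m, n)) (bl bu : 'cV[R]_m)
    (B : {set 'I_m}) (hH : sym_psdmx H) (I : {set 'I_m}) (hI : I \subset B) :
  minimizers (fun x => quad_obj H f x + reg_terms A bl bu I x)
             (miqp_feasible A bl bu B)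
  = minimizers (quad_obj H f) (miqp_feasible A bl bu B).
Proof.
by apply: minimizers_addr => x; exact: reg_terms_feasible.
Qed.
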